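(* Let $X \subset \mathbb{C}^3$ be the surface defined by $f(x,y,z) = x^2 - y^2z + z^3$ and let $m \geq 5$. Let $\Gamma = (V,E)$ be the graph whose vertices are the irreducible components $Z_m^0,Z_m^1,Z_m^2,Z_m^3$ of the singular fiber $X_m^0$, and whose edge set $E$ is the set of maximal elements, for the inclusion relation, of $\{Z_m^i \cap Z_m^j \mid i \neq j\}$, where there is an edge between $Z_m^i$ and $Z_m^j$ ($i \neq j$) if and only if $Z_m^i \cap Z_m^j \in E$. Then $\Gamma$ is (isomorphic to) the resolution graph of a $D_4$-type singularity.
   Context: For $m \geq 0$ let $R_m = \mathbb{C}[x_0,\ldots,x_m,y_0,\ldots,y_m,z_0,\ldots,z_m]$, and define $f^{(0)},\ldots,f^{(m)} \in R_m$ by $f(\sum_{k=0}^m x_kt^k, \sum_{k=0}^m y_kt^k, \sum_{k=0}^m z_kt^k) \equiv \sum_{k=0}^m f^{(k)}t^k \pmod{t^{m+1}}$. The $m$-th jet scheme of $X$ is $X_m = \mathrm{Spec}\,R_m/\langle f^{(0)},\ldots,f^{(m)}\rangle \subseteq \mathbb{A}^{3(m+1)}$, with truncation morphism $\pi_m : X_m \to X$, and $X_m^0 = \pi_m^{-1}(0)$ is the fiber over the origin (a $D_4$-type singular point). Assume $m \geq 5$ and put $L_{322} = \langle x_0,x_1,x_2,y_0,y_1,z_0,z_1\rangle$, $L^1 = \langle x_0,x_1,y_0,z_0,z_1\rangle$, $L^2 = \langle x_0,x_1,y_0,z_0,y_1-z_1\rangle$, $L^3 = \langle x_0,x_1,y_0,z_0,y_1+z_1\rangle$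 (ideals of $R_m$), $I_m^0 = L_{322} + \langle f^{(0)},\ldots,f^{(m)}\rangle$, and $J_m^i = L^i + \langle f^{(0)},\ldots,f^{(m)}\rangle$ for $i = 1,2,3$. Define $Z_m^0 = \mathbf{V}(I_m^0)$ and, for $i = 1,2,3$, $Z_m^i = \overline{\mathbf{V}(J_m^i) \cap \mathbf{D}(y_1)}$, where $\mathbf{D}(y_1)$ is the open subscheme of $X_m$ given by $y_1 \neq 0$ and the bar is Zariski closure in $X_m$. It is known (Mourtada) that for $m \geq 5$ these are irreducible of dimension $2m+1$ and $X_m^0 = Z_m^0 \cup Z_m^1 \cup Z_m^2 \cup Z_m^3$ is the irreducible decomposition. Intersections are taken set-theoretically (as reduced closed subvarieties). The resolution graph of a rational double point is the dual graph of the exceptional curves of its minimal resolution; for type $D_4$ it is the Dynkin diagram $D_4$: one central vertex joined to each of three other vertices, with no further edges. *)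

(* Defs.v *)
From mathcomp Require Import all_boot all_order all_algebra.
From mathcomp Require Import boolp classical_sets reals complex.
From mathcomp Require Import mpoly.

Set Implicit Arguments.
Unset Strict Implicit.
Unset Printing Implicit Defensive.

Import GRing.Theory.

Local Open Scope classical_set_scope.
Local Open Scope ring_scope.

Section Spectrum.
Variable A : comNzRingType.

Definition is_ideal (I : set A) : Prop :=
  [/\ I 0, forall a b, I a -> I b -> I (a + b) & forall a b, I b -> I (a * b)].

Definition is_prime_ideal (P : set A) : Prop :=
  [/\ is_ideal P, ~ P 1 & forall a b, P (a * b) -> P a \/ P b].

Definition ideal_gen (S : set A) : set A := smallest is_ideal S.

Definition ideal_add (I J : set A) : set A :=
  [set c | exists a b, [/\ I a, J b & c = a + b]].

Record Spec := MkSpec {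
  prime_of : set A;
  prime_ofP : is_prime_ideal prime_of }.

Definition Vset (S : set A) : set Spec := [set p | S `<=` prime_of p].

Definition Dset (a : A) : set Spec := [set p | ~ prime_of p a].

(* Zariski closure of [B] in the subspace [X] of [Spec A], whose closed sets
   are the [X `&` Vset S]. *)
Definition closure_in (X B : set Spec) : set Spec :=
  [set p | X p /\ forall S : set A, B `<=` X `&` Vset S -> Vset S p].

End Spectrum.

Definition f_D4 (A : comNzRingType) (x y z : A) : A :=
  x ^+ 2 - y ^+ 2 * z + z ^+ 3.

Section Jets.
Variables (R : realType) (m : nat).

(* The variables come in three blocks of length m + 1. *)
Definition jet_ring : comNzRingType := {mpoly R[i][m.+1 + m.+1 + m.+1]}.

(* [inord k] has value [k] for k <= m, the only range in which these variables
   are meaningful. *)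
Definition xv (k : nat) : jet_ring := 'X_(lshift m.+1 (lshift m.+1 (inord k))).
Definition yv (k : nat) : jet_ring := 'X_(lshift m.+1 (rshift m.+1 (inord k))).
Definition zv (k : nat) : jet_ring := 'X_(rshift (m.+1 + m.+1) (inord k)).

Definition jet_eq (k : nat) : jet_ring :=
  (f_D4 (\poly_(i < m.+1) xv i) (\poly_(i < m.+1) yv i)
        (\poly_(i < m.+1) zv i))`_k.

Definition jet_ideal : set jet_ring :=
  ideal_gen [set g | exists2 k : nat, (k <= m)%N & g = jet_eq k].

(* Spec of the quotient of [jet_ring] by [jet_ideal], as the closed subspace of
   the prime ideals of [jet_ring] which contain [jet_ideal]. *)
Definition jet_scheme : set (Spec jet_ring) := Vset jet_ideal.

Definition ideal_of_seq (s : seq jet_ring) : set jet_ring :=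
  ideal_gen [set g | g \in s].

Definition L322 : set jet_ring :=
  ideal_of_seq [:: xv 0; xv 1; xv 2; yv 0; yv 1; zv 0; zv 1].
Definition L1 : set jet_ring :=
  ideal_of_seq [:: xv 0; xv 1; yv 0; zv 0; zv 1].
Definition L2 : set jet_ring :=
  ideal_of_seq [:: xv 0; xv 1; yv 0; zv 0; yv 1 - zv 1].
Definition L3 : set jet_ring :=
  ideal_of_seq [:: xv 0; xv 1; yv 0; zv 0; yv 1 + zv 1].

Definition Z0 : set (Spec jet_ring) := Vset (ideal_add L322 jet_ideal).

Definition Zcl (L : set jet_ring) : set (Spec jet_ring) :=
  closure_in jet_scheme (Vset (ideal_add L jet_ideal) `&` Dset (yv 1)).

(* By a theorem of Mourtada, for m >= 5 these four closed sets are the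
   irreducible components of the fiber of [jet_scheme] over the origin. *)
Definition Zcomp (i : 'I_4) : set (Spec jet_ring) :=
  match val i with
  | 0%N => Z0
  | 1%N => Zcl L1
  | 2%N => Zcl L2
  | _ => Zcl L3
  end.

End Jets.

Record graph := Graph {
  vertex : Type;
  adj : vertex -> vertex -> Prop }.

Definition graph_iso (G H : graph) : Prop :=
  exists2 h : vertex G -> vertex H,
    bijective h & forall u v, adj u v <-> adj (h u) (h v).

Section IntersectionGraph.
Variables (T : Type) (n : nat) (Z : 'I_n -> set T).

Definition pair_intersections : set (set T) :=
  [set W | exists i j, i != j /\ W = Z i `&` Z j].

Definition maximal_intersections : set (set T) :=
  [set W | pair_intersections W /\
    forall W', pair_intersections W' -> W `<=` W' -> W' = W].

(* The vertices are the sets [Z i] themselves, not their indices. *)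
Definition intersection_graph : graph :=
  @Graph (range Z) (fun u v => exists i j,
    [/\ i != j, val u = Z i, val v = Z j & maximal_intersections (Z i `&` Z j)]).

End IntersectionGraph.

(* Dynkin diagram of type D_4, with central vertex 0. *)
Definition D4_graph : graph :=
  @Graph 'I_4 (fun i j => (i == ord0) != (j == ord0)).

(* Main.v *)
Require Import Defs.
From mathcomp Require Import all_boot all_order all_algebra.
From mathcomp Require Import boolp classical_sets reals complex.
From mathcomp Require Import mpoly ring.

Set Implicit Arguments.
Unset Strict Implicit.
Unset Printing Implicit Defensive.

Import GRing.Theory Num.Theory.

Local Open Scope classical_set_scope.
Local Open Scope ring_scope.

(** The cubic part of [f] is, up to sign, the product of the three linear forms
    [z], [z - y] and [z + y], that is of the [z - s * y] for [s] in [{0, 1, -1}],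
    the solutions of [s ^ 3 = s].  The component [Z_i] with [i <> 0] consists of
    limits of jets [(x, y, z)] of order at least (2, 1, 1) whose velocity
    [(y_1, z_1)] is a nonzero vector of the line [z = s * y] with [s = slope i].
    This makes the three cases uniform in [s]: with [w = z - s * y] and
    [a = 3 * s ^ 2 - 1], the equation of the surface reads
      [f = x ^ 2 + a * y ^ 2 * w + 3 * s * y * w ^ 2 + w ^ 3].

    The graph is a star with center [Z_0] as soon as two facts hold for distinct
    [i, j <> 0] ([intersection_graph_star]):
    - [Z_i] and [Z_j] meet inside [Z_0] ([Zcomp_meet]).  A common point has its
      velocity on two distinct lines, so [y_1 = z_1 = 0], and then [f^(4) = 0]
      reduces to [x_2 ^ 2 = 0];
    - [Z_0] and [Z_i] do not meet inside [Z_j] ([Zcomp_separated]).  The jet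
      [(0, t ^ 2, s * t ^ 2)] with [s = slope i] lies in [Z_0], and in [Z_i] as the
      limit for [e -> 0] of the jets of the curves [(0, e t + t ^ 2,
      s * (e t + t ^ 2))], which lie on the line [x = 0], [z = s * y] of the surface
      ([Zcomp_center_point]).  It is not in [Z_j]: eliminating [x_2]
      between [f^(4)] and [f^(5)] and dividing by [y_1 ^ 2] yields an equation that
      holds on all of [Z_j] ([Zcomp_branch_equation]) and fails at this jet.

    These facts also imply that the four components are distinct.  Since the
    points are prime ideals, a limit point is a prime that contains a prime of
    the family: both jets above are kernels of evaluations, of the jet ring in
    [C[e]] and in [C], and the second factors through the first by [e = 0]. *)

(** * Intersection graphs that are stars *)

(** Each [Z i `&` Z j] away from the center is contained in the strictly larger
    [Z ord0 `&` Z i], while the [Z ord0 `&` Z i] are pairwise incomparable, so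
    that exactly these are maximal.  If a vertex set or an intersection came from
    two different (pairs of) indices, one of the excluded inclusions would hold. *)
Lemma intersection_graph_star (T : Type) (Z : 'I_4 -> set T) :
    (forall i j, i != ord0 -> j != ord0 -> i != j -> Z i `&` Z j `<=` Z ord0) ->
    (forall i j, i != ord0 -> j != ord0 -> i != j ->
      ~ Z ord0 `&` Z i `<=` Z j) ->
  graph_iso (intersection_graph Z) D4_graph.
Proof.
move=> center separated.
have separatedE i j : i != ord0 -> Z ord0 `&` Z i `<=` Z j -> j = ord0 \/ j = i.
  move=> i0 sub; case: (eqVneq j ord0) => [|j0]; first by left.
  by case: (eqVneq i j) => [->|ij]; [right | case: (separated i j)].
(* The central set and some leaf cannot be equal, because a second leaf would
   meet that leaf in its whole intersection with the center. *)
have Z0_neq i : i != ord0 -> Z i <> Z ord0.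
  move=> i0 eqZ.
  have [j j0 ij] : exists2 j : 'I_4, j != ord0 & i != j.
    case: i i0 {eqZ} => -[|[|k]] ilt // _; [exists (inord 2)|exists (inord 1)];
      by rewrite -val_eqE /= inordK.
  by apply: (separated j i) => //; [rewrite eq_sym | rewrite eqZ => t []].
have Zinj : injective Z.
  move=> i j eqZ; case: (eqVneq i ord0) => [i0|i0].
    by case: (eqVneq j ord0) => [->//|/Z0_neq[]]; rewrite -eqZ i0.
  have /separatedE-/(_ i0)[j0|//] : Z ord0 `&` Z i `<=` Z j by rewrite eqZ => t [].
  by have := Z0_neq i i0; rewrite eqZ j0.
have maxE i j : i != j ->
    (maximal_intersections Z (Z i `&` Z j) <-> (i == ord0) != (j == ord0)).
  have maximal0 k : k != ord0 -> maximal_intersections Z (Z ord0 `&` Z k).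
    move=> k0; split; first by exists ord0, k; rewrite eq_sym.
    move=> _ [a [b [ab ->]]] sub.
    have /(separatedE k a k0) : Z ord0 `&` Z k `<=` Z a by move=> t /sub[].
    have /(separatedE k b k0) : Z ord0 `&` Z k `<=` Z b by move=> t /sub[].
    move: ab => /eqP ab [] eb [] ea; rewrite ea eb // in ab *.
    exact: setIC.
  move=> ij; case: (eqVneq i ord0) => [i0|i0]; case: (eqVneq j ord0) => [j0|j0] /=.
  - by rewrite i0 j0 eqxx in ij.
  - by rewrite i0; split=> // _; exact: maximal0.
  - by rewrite j0 setIC; split=> // _; exact: maximal0.
  - split=> // -[_ maxij]; case: (separated i j) => //.
    have -> : Z ord0 `&` Z i = Z i `&` Z j; last by move=> t [].
    apply: maxij => [|t [ti tj]]; first by exists ord0, i; rewrite eq_sym.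
    by split=> //; apply: (center i j).
have in_range i : Z i \in range Z by apply/mem_set; exists i.
pose vtx i : range Z := exist _ (Z i) (in_range i).
have vtx_inj : injective vtx by move=> i j /(congr1 val) /Zinj.
have /choice[h hP] (u : range Z) : exists i, vtx i = u.
  by case: u => W WZ; have [i _ eqW] := set_mem WZ; exists i; apply/val_inj.
exists h; first by exists vtx => [u|i]; [exact: hP | apply/vtx_inj/hP].
move=> u v; rewrite /= -{1}(hP u) -{1}(hP v); split.
  by move=> [i [j [ij /Zinj-> /Zinj-> /maxE->]]].
move=> uv; exists (h u), (h v).
have huv : h u != h v by apply: contraNneq uv => ->.
by split=> //; apply/maxE.
Qed.

(** * Prime ideals and closures in the spectrum *)

Section Ideals.
Variable A : comNzRingType.

Lemma ideal_gen_sub (S I : set A) : is_ideal I -> (ideal_gen S `<=` I) = (S `<=` I).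
Proof.
move=> idI; apply/propeqP; split=> [sub|]; last exact: smallest_sub.
exact: (subset_trans (@sub_gen_smallest _ (@is_ideal A) S)).
Qed.

Lemma ideal_gen0 (S : set A) : ideal_gen S 0.
Proof. by move=> I [[]]. Qed.

Lemma Vset_ideal_add (S T : set A) :
  Vset (ideal_add (ideal_gen S) (ideal_gen T)) = Vset S `&` Vset (ideal_gen T).
Proof.
apply/seteqP; split=> p; have [idp _ _] := prime_ofP p; have [_ pD _] := idp.
  move=> sub; split; last first.
    by move=> b Tb; apply: sub; exists 0, b; split; rewrite ?add0r//; exact: ideal_gen0.
  rewrite /Vset/= -(ideal_gen_sub S idp) => a Sa.
  by apply: sub; exists a, 0; split; rewrite ?addr0//; exact: ideal_gen0.
move=> [/= Sp Tp] _ [a [b [Sa Tb ->]]]; apply: pD; last exact: Tp.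
by move: a Sa; rewrite -/(_ `<=` _) ideal_gen_sub.
Qed.

Lemma ideal_addr_eq (I : set A) (a b : A) :
  is_ideal I -> I (a + b) -> I b -> I a.
Proof.
move=> [_ ID IM] Iab Ib; have -> : a = (a + b) + (-1) * b by ring.
by apply: ID => //; exact: IM.
Qed.

(** Equations of a family of points persist in its closure. *)
Lemma closure_in_sub (X B : set (Spec A)) (g : A) (p : Spec A) :
    B `<=` X -> (forall q, B q -> prime_of q g) -> closure_in X B p ->
  prime_of p g.
Proof.
move=> BX Bg [_ /(_ [set g])]; apply=> // q Bq; split; first exact: BX.
by move=> _ ->; exact: Bg.
Qed.

(** The algebraic form of passing to a limit: a point of the family may be
    replaced by any specialization of it inside [X]. *)
Lemma specialization_closure_in (X B : set (Spec A)) (q p : Spec A) :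
  X p -> B q -> prime_of q `<=` prime_of p -> closure_in X B p.
Proof. by move=> Xp Bq qp; split=> // S /(_ q Bq)[_ Sq]; exact: subset_trans qp. Qed.

Lemma kernel_prime (B : idomainType) (phi : {rmorphism A -> B}) :
  is_prime_ideal [set a | phi a = 0].
Proof.
split; first split=> /= [|a b ea eb|a b eb].
- exact: rmorph0.
- by rewrite rmorphD ea eb addr0.
- by rewrite rmorphM eb mulr0.
- by rewrite /= rmorph1; exact/eqP/oner_neq0.
by move=> a b /= /eqP; rewrite rmorphM mulf_eq0 => /orP[]/eqP; [left|right].
Qed.

Lemma prime_expr2 (I : set A) (a : A) : is_prime_ideal I -> I (a ^+ 2) -> I a.
Proof. by move=> [_ _ IP]; rewrite expr2 => /IP[]. Qed.

End Ideals.

(** * The coefficients of degree 4 and 5 of the jet equations *)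

Section Coefficients.
Variables (A : comNzRingType) (s : A) (x y z : {poly A}).
Hypothesis s3 : s ^+ 3 = s.
Let w := z - s%:P * y.

(** The line [w = 0] divides the cubic part of [f] because [s ^+ 3 = s]. *)
Lemma f_D4_slope : f_D4 x y z =
  x ^+ 2 + (3 * s ^+ 2 - 1)%:P * y ^+ 2 * w + (3 * s)%:P * y * w ^+ 2 + w ^+ 3.
Proof.
have s3P : s%:P ^+ 3 = s%:P :> {poly A} by rewrite -rmorphXn s3.
rewrite /f_D4 /w !(rmorphB, rmorphM, rmorphXn, rmorph1, rmorph_nat) /=.
transitivity (x ^+ 2 - y ^+ 2 * z + z ^+ 3 + (s%:P - s%:P ^+ 3) * y ^+ 3).
  by rewrite s3P subrr mul0r addr0.
ring.
Qed.

(** The first two terms are what remains modulo [x_0, x_1, y_0, w_0, w_1]; the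
    others are grouped by the generator they are multiples of. *)
Lemma f_D4_coef4 : (f_D4 x y z)`_4 =
  x`_2 ^+ 2 + (3 * s ^+ 2 - 1) * y`_1 ^+ 2 * w`_2 +
  (x`_0 * (2 * x`_4) + x`_1 * (2 * x`_3) +
   y`_0 * ((3 * s ^+ 2 - 1) *
             (y`_0 * w`_4 + 2 * y`_1 * w`_3 + 2 * y`_2 * w`_2) +
           3 * s * w`_2 ^+ 2) +
   w`_0 * ((3 * s ^+ 2 - 1) *
             (2 * y`_0 * y`_4 + 2 * y`_1 * y`_3 + y`_2 ^+ 2) +
           3 * s * (2 * y`_0 * w`_4 + 2 * y`_1 * w`_3 + 2 * y`_2 * w`_2 +
                    2 * y`_3 * w`_1 + y`_4 * w`_0) +
           3 * w`_0 * w`_4 + 6 * w`_1 * w`_3 + 3 * w`_2 ^+ 2) +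
   w`_1 * ((3 * s ^+ 2 - 1) * (2 * y`_0 * y`_3 + 2 * y`_1 * y`_2) +
           3 * s * (2 * y`_0 * w`_3 + 2 * y`_1 * w`_2 + y`_2 * w`_1) +
           3 * w`_1 * w`_2)).
Proof.
rewrite f_D4_slope; clearbody w.
rewrite !coefD !exprS !expr0 !mulr1 -!mulrA !coefCM.
rewrite !(coefM, big_ord_recl, big_ord0) /= /bump /= !(addn0, add1n, subn0, subSS).
ring.
Qed.

Lemma f_D4_coef5 : (f_D4 x y z)`_5 =
  2 * x`_2 * x`_3 +
  y`_1 * ((3 * s ^+ 2 - 1) * (y`_1 * w`_3 + 2 * y`_2 * w`_2) +
          3 * s * w`_2 ^+ 2) +
  (x`_0 * (2 * x`_5) + x`_1 * (2 * x`_4) +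
   y`_0 * ((3 * s ^+ 2 - 1) *
             (y`_0 * w`_5 + 2 * y`_1 * w`_4 + 2 * y`_2 * w`_3 +
              2 * y`_3 * w`_2) +
           6 * s * w`_2 * w`_3) +
   w`_0 * ((3 * s ^+ 2 - 1) *
             (2 * y`_0 * y`_5 + 2 * y`_1 * y`_4 + 2 * y`_2 * y`_3) +
           3 * s * (2 * y`_0 * w`_5 + 2 * y`_1 * w`_4 + 2 * y`_2 * w`_3 +
                    2 * y`_3 * w`_2 + 2 * y`_4 * w`_1 + y`_5 * w`_0) +
           3 * w`_0 * w`_5 + 6 * w`_1 * w`_4 + 6 * w`_2 * w`_3) +
   w`_1 * ((3 * s ^+ 2 - 1) *
             (2 * y`_0 * y`_4 + 2 * y`_1 * y`_3 + y`_2 ^+ 2) +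
           3 * s * (2 * y`_0 * w`_4 + 2 * y`_1 * w`_3 + 2 * y`_2 * w`_2 +
                    y`_3 * w`_1) +
           3 * w`_1 * w`_3 + 3 * w`_2 ^+ 2)).
Proof.
rewrite f_D4_slope; clearbody w.
rewrite !coefD !exprS !expr0 !mulr1 -!mulrA !coefCM.
rewrite !(coefM, big_ord_recl, big_ord0) /= /bump /= !(addn0, add1n, subn0, subSS).
ring.
Qed.

Variable I : set A.
Hypothesis prime_I : is_prime_ideal I.
Hypotheses (x0 : I x`_0) (x1 : I x`_1) (y0 : I y`_0) (z0 : I z`_0).
Hypothesis z1 : I (z`_1 - s * y`_1).

Let wE k : w`_k = z`_k - s * y`_k.
Proof. by rewrite coefB coefCM. Qed.

Let idI : is_ideal I. Proof. by case: prime_I. Qed.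
Let ID a b : I a -> I b -> I (a + b). Proof. by case: idI => _ + _; apply. Qed.
Let IMr a b : I a -> I (a * b).
Proof. by rewrite mulrC; case: idI => _ _; apply. Qed.
Let w0 : I w`_0.
Proof. by rewrite wE -mulrN mulrC mulNr -mulrN; apply: ID => //; exact: IMr. Qed.
Let w1 : I w`_1. Proof. by rewrite wE. Qed.

Lemma tangent_coef4 : I (f_D4 x y z)`_4 ->
  I (x`_2 ^+ 2 + (3 * s ^+ 2 - 1) * y`_1 ^+ 2 * w`_2).
Proof.
by rewrite f_D4_coef4 => /ideal_addr_eq; apply=> //; do ![apply: ID | apply: IMr].
Qed.

Lemma tangent_coef5 : I (f_D4 x y z)`_5 ->
  I (2 * x`_2 * x`_3 +
     y`_1 * ((3 * s ^+ 2 - 1) * (y`_1 * w`_3 + 2 * y`_2 * w`_2) +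
             3 * s * w`_2 ^+ 2)).
Proof.
by rewrite f_D4_coef5 => /ideal_addr_eq; apply=> //; do ![apply: ID | apply: IMr].
Qed.

(** A jet with vanishing velocity also has [x_2 = 0]: the coefficient of degree 4
    reduces to [x_2 ^ 2]. *)
Lemma singular_x2 : I (f_D4 x y z)`_4 -> I y`_1 -> I x`_2.
Proof.
move=> /tangent_coef4 E y1; apply: (prime_expr2 prime_I).
by apply: ideal_addr_eq E _ => //; rewrite expr2 mulrAC mulrC -mulrA; exact: IMr.
Qed.

(** Modulo the tangency conditions, the equations of degree 4 and 5 read
    [x_2 ^ 2 = - a y_1 ^ 2 w_2] and [2 x_2 x_3 = - y_1 T].  Squaring the second one
    and substituting the first gives [y_1 ^ 2 (4 a w_2 x_3 ^ 2 + T ^ 2) = 0]; the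
    second factor therefore lies in every prime that does not contain [y_1]. *)
Definition branch_equation : A :=
  4 * (3 * s ^+ 2 - 1) * w`_2 * x`_3 ^+ 2 +
  ((3 * s ^+ 2 - 1) * (y`_1 * w`_3 + 2 * y`_2 * w`_2) + 3 * s * w`_2 ^+ 2) ^+ 2.

Lemma branch_equation_in :
  I (f_D4 x y z)`_4 -> I (f_D4 x y z)`_5 -> ~ I y`_1 -> I branch_equation.
Proof.
move=> /tangent_coef4 E4 /tangent_coef5 E5 y1.
have [_ _ /(_ (y`_1 ^+ 2) branch_equation)[|/(prime_expr2 prime_I)//|//]] := prime_I.
rewrite /branch_equation; set T := _ * (_ + _) + _ in E5 *.
have -> : y`_1 ^+ 2 * (4 * (3 * s ^+ 2 - 1) * w`_2 * x`_3 ^+ 2 + T ^+ 2) =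
  (x`_2 ^+ 2 + (3 * s ^+ 2 - 1) * y`_1 ^+ 2 * w`_2) * (4 * x`_3 ^+ 2) +
  (2 * x`_2 * x`_3 + y`_1 * T) * (y`_1 * T - 2 * x`_2 * x`_3) by ring.
by apply: ID; exact: IMr.
Qed.

End Coefficients.

(** * Evaluation of the jet ring *)

(** Truncated arcs are points of the jet scheme: an arc [(x, y, z)] with coefficients in a
    [C]-algebra evaluates the equations [f^(n)] to the coefficients of
    [f (x, y, z)]. *)
Lemma jet_evaluation (R : realType) (m : nat) (B : comNzRingType)
    (k : {rmorphism R[i] -> B}) (x y z : {poly B}) :
    (size x <= m.+1)%N -> (size y <= m.+1)%N -> (size z <= m.+1)%N ->
  exists phi : {rmorphism jet_ring R m -> B},
    [/\ forall n, (n <= m)%N -> phi (xv R m n) = x`_n,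
        forall n, (n <= m)%N -> phi (yv R m n) = y`_n,
        forall n, (n <= m)%N -> phi (zv R m n) = z`_n &
        forall n, phi (jet_eq R m n) = (f_D4 x y z)`_n].
Proof.
move=> sx sy sz.
pose h (i : 'I_(m.+1 + m.+1 + m.+1)) : B :=
  match split i with
  | inl j => match split j with inl n => x`_n | inr n => y`_n end
  | inr n => z`_n
  end.
pose phi : {rmorphism jet_ring R m -> B} := mmap k h.
have phix n : (n <= m)%N -> phi (xv R m n) = x`_n.
  move=> nm; rewrite [LHS]mmapX mmap1U /h.
  by rewrite (unsplitK (inl _)) (unsplitK (inl _)) inordK.
have phiy n : (n <= m)%N -> phi (yv R m n) = y`_n.
  move=> nm; rewrite [LHS]mmapX mmap1U /h.
  by rewrite (unsplitK (inl _)) (unsplitK (inr _)) inordK.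
have phiz n : (n <= m)%N -> phi (zv R m n) = z`_n.
  by move=> nm; rewrite [LHS]mmapX mmap1U /h (unsplitK (inr _)) inordK.
clearbody phi.
have phiP v (t : {poly B}) : (size t <= m.+1)%N ->
    (forall n, (n <= m)%N -> phi (v n) = t`_n) ->
    map_poly phi (\poly_(i < m.+1) v i) = t.
  move=> st vt; apply/polyP => n; rewrite coef_map coef_poly ltnS.
  case: leqP => [/vt//|mn]; rewrite [RHS]nth_default; first exact: (rmorph0 phi).
  exact: leq_trans mn.
exists phi; split=> // n; rewrite -(coef_map phi) /f_D4.
rewrite rmorphD rmorphB !rmorphXn rmorphM rmorphXn /=.
by rewrite (phiP (xv R m) x) // (phiP (yv R m) y) // (phiP (zv R m) z).
Qed.

(** * The components of the fiber over the origin *)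

(** The jets of [Zcomp i] leave the origin along the line [z = slope i * y] of the
    plane [x = 0]. *)
Definition slope (i : 'I_4) : int :=
  match val i with 1%N => 0 | 2%N => 1 | _ => -1 end.

Lemma slope_exp3 (i : 'I_4) : slope i ^+ 3 = slope i.
Proof. by case: i => [[|[|[|[|]]]]]. Qed.

Section JetComponents.
Variables (R : realType) (m : nat).
Hypothesis m5 : (5 <= m)%N.

Definition xs : {poly jet_ring R m} := \poly_(i < m.+1) xv R m i.
Definition ys : {poly jet_ring R m} := \poly_(i < m.+1) yv R m i.
Definition zs : {poly jet_ring R m} := \poly_(i < m.+1) zv R m i.

Definition tangent (s : int) : set (Spec (jet_ring R m)) :=
  [set q | [/\ prime_of q (xv R m 0), prime_of q (xv R m 1),
    prime_of q (yv R m 0), prime_of q (zv R m 0) &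
    prime_of q (zv R m 1 - s%:~R * yv R m 1)]].

Definition branch (s : int) : set (Spec (jet_ring R m)) :=
  tangent s `&` @jet_scheme R m `&` Dset (yv R m 1).

Lemma Vset_line (g : jet_ring R m) (s : int) (p : Spec (jet_ring R m)) :
    (prime_of p g <-> prime_of p (zv R m 1 - s%:~R * yv R m 1)) ->
  Vset [set h | h \in [:: xv R m 0; xv R m 1; yv R m 0; zv R m 0; g]] p <->
  tangent s p.
Proof.
move=> gs; split=> [sub|[x0 x1 y0 z0 /gs gp] h] /=.
  by split; rewrite -?gs; apply: sub; rewrite /= !inE !eqxx ?orbT.
by rewrite !inE => /or4P[||| /orP[]] /eqP->.
Qed.

(** The generators [y_1 - z_1] and [y_1 + z_1] of [L2] and [L3] are up to sign the
    equation [z_1 - s * y_1] of slope 1 and -1. *)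
Lemma Zcomp_branch (i : 'I_4) : i != ord0 ->
  @Zcomp R m i = closure_in (@jet_scheme R m) (branch (slope i)).
Proof.
have oppE (p : Spec (jet_ring R m)) (a b : jet_ring R m) :
    a = - b -> (prime_of p a <-> prime_of p b).
  have [[_ _ IM] _ _] := prime_ofP p.
  by move=> ->; split=> [/(IM (-1))|/(IM (-1))]; rewrite mulN1r ?opprK.
case: i => -[|[|[|[|//]]]] i4 // _; rewrite /Zcomp /= /Zcl;
  rewrite /L1 /L2 /L3 /ideal_of_seq Vset_ideal_add;
  congr (closure_in _ (_ `&` _ `&` _)); apply/seteqP; split=> p /Vset_line; apply;
  rewrite /slope /=.
- by rewrite mul0r subr0.
- by rewrite mul0r subr0.
- by apply: oppE; rewrite mul1r opprB.
- by apply: oppE; rewrite mul1r opprB.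
- by rewrite mulN1r opprK addrC.
- by rewrite mulN1r opprK addrC.
Qed.

Lemma Zcomp_tangent (i : 'I_4) (p : Spec (jet_ring R m)) : i != ord0 ->
  @Zcomp R m i p -> @jet_scheme R m p /\ tangent (slope i) p.
Proof.
move=> i0; rewrite Zcomp_branch // => Zp; split; first by case: Zp.
by split; apply: closure_in_sub Zp => [q [[]]//|q [[[]]]].
Qed.

Lemma jet_scheme_coef (p : Spec (jet_ring R m)) k :
  @jet_scheme R m p -> (k <= m)%N -> prime_of p (f_D4 xs ys zs)`_k.
Proof.
have [idp _ _] := prime_ofP p.
by rewrite /jet_scheme /Vset /= ideal_gen_sub // => sub km; apply: sub; exists k.
Qed.

Lemma jet_schemeP (p : Spec (jet_ring R m)) :
  (forall k, prime_of p (jet_eq R m k)) -> @jet_scheme R m p.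
Proof.
have [idp _ _] := prime_ofP p => pE.
by rewrite /jet_scheme /Vset /= ideal_gen_sub // => _ [k _ ->].
Qed.

Lemma xsE k : (k <= m)%N -> xs`_k = xv R m k.
Proof. by move=> km; rewrite coef_poly ltnS km. Qed.
Lemma ysE k : (k <= m)%N -> ys`_k = yv R m k.
Proof. by move=> km; rewrite coef_poly ltnS km. Qed.
Lemma zsE k : (k <= m)%N -> zs`_k = zv R m k.
Proof. by move=> km; rewrite coef_poly ltnS km. Qed.

Let small k : (k <= 5)%N -> (k <= m)%N.
Proof. by move=> /leq_trans; apply. Qed.

(** The residue fields contain the complex numbers, so they have characteristic
    zero. *)
Lemma intr_prime_of (d : int) (p : Spec (jet_ring R m)) :
  d != 0 -> ~ prime_of p d%:~R.
Proof.
move=> d0; have [[_ _ IM] p1 _] := prime_ofP p.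
move=> /(IM ((d%:~R : R[i])^-1)%:MP); rewrite -(rmorph_int (@mpolyC _ R[i])).
by rewrite -rmorphM mulVf ?rmorph1 // intr_eq0.
Qed.

(** The two tangent lines are different, so the velocity of a common point is
    zero. *)
Lemma Zcomp_meet (i j : 'I_4) : i != ord0 -> j != ord0 -> i != j ->
  @Zcomp R m i `&` @Zcomp R m j `<=` @Zcomp R m ord0.
Proof.
move=> i0 j0 ij p [/(Zcomp_tangent i0)[Xp [x0 x1 y0 z0 z1i]]].
move=> /(Zcomp_tangent j0)[_ [_ _ _ _ z1j]].
have [idp _ pP] := prime_ofP p; have [_ ID IM] := idp.
have y1 : prime_of p (yv R m 1).
  have : prime_of p ((slope j - slope i)%:~R * yv R m 1).
    have -> : (slope j - slope i)%:~R * yv R m 1 =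
      (zv R m 1 - (slope i)%:~R * yv R m 1) +
      (-1) * (zv R m 1 - (slope j)%:~R * yv R m 1) by rewrite rmorphB /=; ring.
    by apply: ID => //; exact: IM.
  case/pP=> // /intr_prime_of[].
  by case: i i0 ij {z1i} => -[|[|[|[|//]]]] ? //; case: j j0 {z1j} => -[|[|[|[|//]]]].
have z1 : prime_of p (zv R m 1).
  apply: (@ideal_addr_eq _ _ _ (- ((slope i)%:~R * yv R m 1))) => //.
  by rewrite -mulNr; exact: IM.
have x2 : prime_of p (xv R m 2).
  rewrite -xsE ?small //.
  apply: (@singular_x2 _ (slope i)%:~R xs ys zs); rewrite ?xsE ?ysE ?zsE ?small //.
  - by rewrite -rmorphXn slope_exp3.
  - exact: prime_ofP.
  - by apply: jet_scheme_coef; rewrite ?small.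
rewrite /Zcomp /= /Z0 /L322 /ideal_of_seq Vset_ideal_add; split=> // h /=.
by rewrite !inE => /or4P[||| /or4P[]] /eqP->.
Qed.

Lemma Zcomp_branch_equation (i : 'I_4) (p : Spec (jet_ring R m)) : i != ord0 ->
  @Zcomp R m i p -> prime_of p (branch_equation (slope i)%:~R xs ys zs).
Proof.
move=> i0; rewrite Zcomp_branch //.
apply: closure_in_sub => [q [[]]//|q [[[x0 x1 y0 z0 z1] Xq] y1]].
apply: branch_equation_in; rewrite ?xsE ?ysE ?zsE ?small //.
- by rewrite -rmorphXn slope_exp3.
- exact: prime_ofP.
- by apply: jet_scheme_coef; rewrite ?small.
- by apply: jet_scheme_coef; rewrite ?small.
Qed.

(** The jet of [(0, t ^ 2, s * t ^ 2)].  It specializes the jet over [C[e]] of the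
    arc [(0, Y, s * Y)] with [Y = e t + t ^ 2], which satisfies [f = 0] because
    [s ^ 3 = s] and which has [y_1 = e <> 0]. *)
Lemma Zcomp_center_point (i : 'I_4) : i != ord0 ->
  exists (p : Spec (jet_ring R m)) (psi : {rmorphism jet_ring R m -> R[i]}),
    [/\ @Zcomp R m ord0 p, @Zcomp R m i p,
        forall g, prime_of p g -> psi g = 0 &
        forall k, (k <= m)%N ->
          [/\ psi (xv R m k) = 0, psi (yv R m k) = (k == 2)%:R &
              psi (zv R m k) = (slope i)%:~R * (k == 2)%:R]].
Proof.
move=> i0.
pose s : {poly R[i]} := (slope i)%:~R.
(* The inner variable is [e], the outer one is the parameter [t] of the arc. *)
pose Y : {poly {poly R[i]}} := 'X%:P * 'X + 'X^2.
have Yn n : Y`_n = if n is 1 then 'X else (n == 2)%:R.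
  case: n => [|[|[|n]]]; rewrite coefD coefCM coefX coefXn /=;
  by rewrite ?mulr0 ?mulr1 ?addr0 ?add0r.
have sY : (size Y <= m.+1)%N.
  apply/leq_sizeP => n mn; rewrite Yn.
  by case: n mn => [|[|[|n]]] //; rewrite ltnNge small.
have sZ : (size (s%:P * Y)%R <= m.+1)%N.
  by apply/leq_sizeP => n mn; rewrite coefCM nth_default ?mulr0 // (leq_trans sY).
have s0 : (size (0%R : {poly {poly R[i]}}) <= m.+1)%N by rewrite size_poly0.
have [phi [phix phiy phiz phif]] := jet_evaluation polyC s0 sY sZ.
have phi0 k : phi (jet_eq R m k) = 0.
  rewrite phif /f_D4.
  have -> : 0 ^+ 2 - Y ^+ 2 * (s%:P * Y) + (s%:P * Y) ^+ 3 =
    (s%:P ^+ 3 - s%:P) * Y ^+ 3 by ring.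
  by rewrite -!rmorphXn slope_exp3 subrr mul0r coef0.
pose ev0 : {rmorphism {poly R[i]} -> R[i]} := horner_eval 0.
pose psi : {rmorphism jet_ring R m -> R[i]} := ev0 \o phi.
have psiY k : ev0 Y`_k = (k == 2)%:R.
  rewrite Yn /= /horner_eval; case: k => [|[|k]]; last by rewrite hornerMn hornerC.
    exact: horner0.
  exact: hornerX.
have psis : ev0 s = (slope i)%:~R by exact: rmorph_int.
have psiE k : (k <= m)%N ->
    [/\ psi (xv R m k) = 0, psi (yv R m k) = (k == 2)%:R &
        psi (zv R m k) = (slope i)%:~R * (k == 2)%:R].
  move=> km; split; first by rewrite /= phix // coef0 [LHS]rmorph0.
    by rewrite /= phiy // psiY.
  by rewrite /= phiz // coefCM -psiY -psis; exact: rmorphM.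
pose q := MkSpec (kernel_prime phi).
pose p := MkSpec (kernel_prime psi).
have qp : prime_of q `<=` prime_of p by move=> g /= ->; exact: rmorph0.
have Xq : @jet_scheme R m q by apply: jet_schemeP.
have Xp : @jet_scheme R m p by apply: subset_trans qp.
have bq : branch (slope i) q.
  have y1 : phi (yv R m 1) <> 0.
    by rewrite phiy ?small // Yn; apply/eqP; rewrite polyX_eq0.
  have z1 : phi (zv R m 1 - (slope i)%:~R * yv R m 1) = 0.
    rewrite rmorphB rmorphM rmorph_int phiz ?phiy ?small // coefCM.
    exact: subrr.
  split; last exact: y1.
  split; last exact: Xq.
  split; last (exact: z1); rewrite /= ?phix ?phiy ?phiz ?small ?coef0 //.
  by rewrite coefCM Yn mulr0.
exists p, psi; split=> //.
- rewrite /Zcomp /= /Z0 /L322 /ideal_of_seq Vset_ideal_add; split=> // h.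
  have px k : (k <= 5)%N -> prime_of p (xv R m k).
    by move=> k5; have [] := psiE k (small k5).
  have py k : (k <= 5)%N -> k != 2 -> prime_of p (yv R m k).
    by move=> k5 /negPf k2; have [_ + _] := psiE k (small k5); rewrite k2.
  have pz k : (k <= 5)%N -> k != 2 -> prime_of p (zv R m k).
    by move=> k5 /negPf k2; have [_ _] := psiE k (small k5); rewrite k2 mulr0.
  rewrite /= !inE => /or4P[||| /or4P[]] /eqP->;
    by [exact: px | exact: py | exact: pz].
- by rewrite Zcomp_branch //; apply: specialization_closure_in bq qp.
Qed.

Lemma Zcomp_separated (i j : 'I_4) : i != ord0 -> j != ord0 -> i != j ->
  ~ @Zcomp R m ord0 `&` @Zcomp R m i `<=` @Zcomp R m j.
Proof.
move=> i0 j0 ij sub.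
have [p [psi [Z0p Zip psi0 psiE]]] := Zcomp_center_point i0.
have := psi0 _ (Zcomp_branch_equation j0 (sub _ (conj Z0p Zip))).
have [x3 _ _] := psiE 3 (@small 3 isT).
have [_ y1 _] := psiE 1 (@small 1 isT).
have [_ y2 z2] := psiE 2 (@small 2 isT).
(* At the jet of slope [s_i] one has [y_1 = x_3 = 0], [y_2 = 1] and
   [w_2 = s_i - s_j], so the equation of [Z_j] takes the value [n ^ 2].  As
   [n = s_i - s_j] modulo 3 and [0 < |s_i - s_j| <= 2], it is nonzero. *)
pose n : int := let d := slope i - slope j in
  (3 * slope j ^+ 2 - 1) * (2 * d) + 3 * slope j * d ^+ 2.
have n0 : n != 0.
  rewrite /n; case: i i0 ij {sub Zip psiE z2 n} => -[|[|[|[|//]]]] i4 // _;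
    by case: j j0 => -[|[|[|[|//]]]] j4.
have -> : psi (branch_equation (slope j)%:~R xs ys zs) = n%:~R ^+ 2.
  rewrite /branch_equation !(coefB, coefCM) !xsE ?ysE ?zsE ?small //.
  pose morphE := (rmorphB, rmorphD, rmorphM, rmorphXn, rmorph_int, rmorph_nat,
                  rmorph1).
  rewrite !morphE /= x3 y1 y2 z2 mulr1 /n /= !morphE /=.
  ring.
by move/eqP; rewrite expf_eq0 intr_eq0 (negPf n0).
Qed.

End JetComponents.

Theorem corollary3p18 (R : realType) (m : nat) (hm : (5 <= m)%N) :
  graph_iso (intersection_graph (@Zcomp R m)) D4_graph.
Proof.
apply: intersection_graph_star => i j; [exact: Zcomp_meet|exact: Zcomp_separated].
Qed.
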